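(* Let $\Gamma$ be a finitely generated group and let $\alpha:\Gamma\to\Gamma$ be an endomorphism. For every real $r>1$, the set $H_r=\{\gamma\in\Gamma:\ \limsup_{n\to\infty}\sqrt[n]{|\alpha^n(\gamma)|}\le r\}$ is a subgroup of $\Gamma$.
   Context: Fix a finite generating set $S$ of $\Gamma$; $|\gamma|=|\gamma|_S$ denotes the length of the shortest word in the letters $S\cup S^{-1}$ representing $\gamma\in\Gamma$. *)

(* Defs.v *)
From HB Require Import structures.
From mathcomp Require Import all_boot all_order all_algebra.
From mathcomp Require Import all_classical all_reals all_analysis.

Set Implicit Arguments.
Unset Strict Implicit.
Unset Printing Implicit Defensive.

Import Order.TTheory GRing.Theory Num.Theory.

Local Open Scope classical_set_scope.
Local Open Scope group_scope.

Definition is_subgroup (G : groupType) (H : set G) : Prop :=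
  group_closed (mem H).

Definition generates (G : groupType) (S : set G) : Prop :=
  smallest (@is_subgroup G) S = [set: G].

Definition is_word (G : groupType) (S : set G) (w : seq G) : Prop :=
  {in w, forall x, S x \/ S x^-1}.

Definition word_lengths (G : groupType) (S : set G) (g : G) : set nat :=
  [set n | exists w : seq G,
     [/\ is_word S w, \prod_(x <- w) x = g & size w = n]].

(* The default value 0 is used only when [word_lengths S g] is empty, which
   cannot happen when S generates G. *)
Definition word_length (G : groupType) (S : set G) (g : G) : nat :=
  xget 0%N [set n | word_lengths S g n /\
                    forall m, word_lengths S g m -> (n <= m)%N].

Local Open Scope ring_scope.

(* n-th roots are the powers [`^ n%:R^-1]; in particular the n-th root of 0 is 0
   for n > 0. The limsup is taken in the extended reals, and the (junk) term
   n = 0 does not affect it. *)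
Definition growth_rate (R : realType) (G : groupType) (S : set G)
    (alpha : G -> G) (g : G) : \bar R :=
  limn_esup (fun n : nat =>
    ((word_length S (iter n alpha g))%:R `^ n%:R^-1)%:E).

Definition growth_le (R : realType) (G : groupType) (S : set G)
    (alpha : G -> G) (r : R) : set G :=
  [set g | (growth_rate R S alpha g <= r%:E)%E].

(* Main.v *)
Require Import Defs.
From HB Require Import structures.
From mathcomp Require Import all_boot all_order all_algebra.
From mathcomp Require Import all_classical all_reals all_analysis.

Set Implicit Arguments.
Unset Strict Implicit.
Unset Printing Implicit Defensive.

Import Order.TTheory GRing.Theory Num.Theory.
Local Open Scope classical_set_scope.
Local Open Scope ring_scope.

(** The word length is a length function on the group: the identity has length
    0, and |x / y| <= |x| + |y| (concatenate a word for x with the formal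
    inverse of a word for y).  Since alpha is an endomorphism, the sequence
    |alpha^n (x / y)| is bounded by |alpha^n x| + |alpha^n y|.

    It remains to see that the growth condition is stable under sums of
    sequences.  For a nonnegative sequence a, having limsup of a_n^(1/n) at most
    r means that for every s > r one has a_n <= s^n for n large
    ([limn_esup_root_leP]).  Now, if r < t < s and both a_n and b_n are
    eventually at most t^n, then a_n + b_n <= 2 t^n, and the constant 2 is
    absorbed by the exponential factor (s / t)^n, so that a_n + b_n <= s^n for n
    large ([limn_esup_rootD]). *)

(** * Word length *)

Section WordLength.
Variables (G : groupType) (S : set G).
Local Open Scope group_scope.

Lemma word_lengths1 : word_lengths S 1 0%N.
Proof. by exists [::]; split=> //; rewrite big_nil. Qed.

(** A word for [x / y] is a word for [x] followed by a word for [y] that has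
    been reversed and inverted letterwise. *)
Lemma word_lengthsF x y m n :
  word_lengths S x m -> word_lengths S y n -> word_lengths S (x / y) (m + n)%N.
Proof.
move=> [u [wu <- <-]] [v [wv <- <-]].
exists (u ++ rev [seq z^-1 | z <- v]); split.
- move=> z; rewrite mem_cat mem_rev => /orP[/wu//|/mapP[t /wv tS ->]].
  by rewrite invgK; case: tS; [right|left].
- by rewrite big_cat -map_rev big_map/= prodgV revK.
- by rewrite size_cat size_rev size_map.
Qed.

(** The elements that are values of words form a subgroup containing the
    generators, hence they exhaust the group. *)
Lemma word_lengths_ex x : generates S -> exists n, word_lengths S x n.
Proof.
move=> S_gen; have: [set: G] x by [].
rewrite -S_gen.
apply: (smallest_sub (X := [set y | exists n, word_lengths S y n])).
- split; first by rewrite inE/=; exists 0%N; exact: word_lengths1.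
  move=> y z; rewrite !inE/= => -[m ym] [n zn].
  by exists (m + n)%N; exact: word_lengthsF.
- move=> y Sy; exists 1%N, [:: y]; split=> //; last by rewrite big_seq1.
  by move=> z; rewrite inE => /eqP ->; left.
Qed.

(** The minimum exists: some word has value [x], and lengths are natural
    numbers. *)
Lemma word_lengthP x : generates S ->
  word_lengths S x (word_length S x) /\
  forall m, word_lengths S x m -> (word_length S x <= m)%N.
Proof.
move=> S_gen; have [n xn] := word_lengths_ex x S_gen.
have exW : exists m, `[< word_lengths S x m >] by exists n; apply/asboolP.
apply: (xgetPex 0%N (P := [set n | word_lengths S x n /\
  forall m, word_lengths S x m -> (n <= m)%N])).
case: (ex_minnP exW) => m /asboolP xm m_min.
by exists m; split=> // k /asboolP; exact: m_min.
Qed.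

Lemma word_length1 : generates S -> word_length S 1 = 0%N.
Proof.
move=> /(word_lengthP 1)[_ /(_ _ word_lengths1)].
by rewrite leqn0 => /eqP.
Qed.

Lemma word_lengthF x y : generates S ->
  (word_length S (x / y) <= word_length S x + word_length S y)%N.
Proof.
move=> S_gen; apply: (word_lengthP _ S_gen).2.
by apply: word_lengthsF; exact: (word_lengthP _ S_gen).1.
Qed.

End WordLength.

(** * Exponential growth rates of real sequences *)

Section RootLimsup.
Variable R : realType.
Implicit Types (a b : R^nat) (r s : R).

(** Reduces bounds on a limit superior to eventual bounds, one for each number
    strictly above the target: the infimum defining it need not be attained. *)
Lemma limf_esup_leP (T : choiceType) (X : filteredType T) (f : X -> \bar R)
    (F : set_system X) r : Filter F ->
  (limf_esup f F <= r%:E)%E <->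
  (forall s, r < s -> \forall x \near F, (f x <= s%:E)%E).
Proof.
move=> FF; rewrite limf_esupE; split=> [fr s rs|fr].
  have /ereal_inf_lt[_ [V FV <-] Vs] :
      (ereal_inf [set ereal_sup (f @` V) | V in F] < s%:E)%E.
    by apply: le_lt_trans fr _; rewrite lte_fin.
  apply: filterS FV => x Vx; apply: le_trans (ltW Vs).
  by apply: ereal_sup_ubound; exists x.
apply/lee_addgt0Pr => e e0; rewrite -EFinD.
have /fr Fe : r < r + e by rewrite ltrDl.
apply: le_trans (_ : (ereal_sup (f @` [set x | (f x <= (r + e)%:E)%E]) <= _)%E).
  by apply: ereal_inf_lbound; exists [set x | (f x <= (r + e)%:E)%E].
by apply: ge_ereal_sup => _ [x ? <-].
Qed.

Lemma powR_invn_le x s n : 0 <= x -> 0 <= s -> (0 < n)%N ->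
  (x `^ n%:R^-1 <= s) = (x <= s ^+ n).
Proof.
move=> x0 s0 n0.
have xE : x = (x `^ n%:R^-1) ^+ n.
  by rewrite -powR_mulrn ?powR_ge0// -powRrM mulVf ?powRr1// pnatr_eq0 -lt0n.
by rewrite [in RHS]xE ler_pXn2r// nnegrE powR_ge0.
Qed.

Lemma limn_esup_root_leP a r : 0 <= r -> (forall n, 0 <= a n) ->
  (limn_esup (fun n => (a n `^ n%:R^-1)%:E) <= r%:E)%E <->
  (forall s, r < s -> \forall n \near \oo, a n <= s ^+ n).
Proof.
move=> r0 a0; rewrite /limn_esup limf_esup_leP.
(* At n = 0 the root is the constant 1, so that index has to be discarded. *)
have aE s n : r < s -> (0 < n)%N ->
    ((a n `^ n%:R^-1)%:E <= s%:E)%E = (a n <= s ^+ n).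
  by move=> rs n0; rewrite lee_fin powR_invn_le// (le_trans r0 (ltW rs)).
split=> ar s rs; near=> n; have n0 : (0 < n)%N by near: n; exact: nbhs_infty_gt.
- by rewrite -aE//; near: n; exact: ar.
- by rewrite aE//; near: n; exact: ar.
Unshelve. all: by end_near. Qed.

(** Between two exponentials with different bases there is room for any constant
    factor; a factor 2 is what adding two sequences costs. *)
Lemma near_exprD_le r s : 0 <= r -> r < s ->
  \forall n \near \oo, r ^+ n + r ^+ n <= s ^+ n.
Proof.
move=> r0 rs; have s0 : 0 < s by exact: le_lt_trans rs.
have q1 : `|r / s| < 1.
  by rewrite ger0_norm ?divr_ge0 ?(ltW s0)// ltr_pdivrMr ?mul1r.
have : \forall n \near \oo, (r / s) ^+ n < 2^-1.
  by apply: (cvgr_lt 0); [exact: cvg_expr|rewrite invr_gt0].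
apply: filterS => n /ltW.
rewrite expr_div_n ler_pdivrMr ?exprn_gt0// mulrC ler_pdivlMr// mulr_natr.
by rewrite mulr2n.
Qed.

Lemma limn_esup_rootD a b r : 0 <= r ->
  (forall n, 0 <= a n) -> (forall n, 0 <= b n) ->
  (limn_esup (fun n => (a n `^ n%:R^-1)%:E) <= r%:E)%E ->
  (limn_esup (fun n => (b n `^ n%:R^-1)%:E) <= r%:E)%E ->
  (limn_esup (fun n => ((a n + b n) `^ n%:R^-1)%:E) <= r%:E)%E.
Proof.
move=> r0 a0 b0 /limn_esup_root_leP ar /limn_esup_root_leP br.
apply/limn_esup_root_leP => // [n|s rs]; first exact: addr_ge0.
have [rt ts] := midf_lt rs; set t := (r + s) / 2 in rt ts.
near=> n; apply: (@le_trans _ _ (t ^+ n + t ^+ n)).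
  by apply: lerD; near: n; [exact: ar|exact: br].
by near: n; apply: near_exprD_le => //; exact: le_trans r0 (ltW rt).
Unshelve. all: by end_near. Qed.

Lemma le_limn_esup_root a b r : 0 <= r -> (forall n, 0 <= a n <= b n) ->
  (limn_esup (fun n => (b n `^ n%:R^-1)%:E) <= r%:E)%E ->
  (limn_esup (fun n => (a n `^ n%:R^-1)%:E) <= r%:E)%E.
Proof.
move=> r0 ab.
have a0 n : 0 <= a n by case/andP: (ab n).
have leab n : a n <= b n by case/andP: (ab n).
have b0 n : 0 <= b n by exact: le_trans (leab n).
move=> /(limn_esup_root_leP r0 b0) br.
apply/limn_esup_root_leP => // s /br.
by apply: filterS => n; exact: le_trans.
Qed.

End RootLimsup.

(** * The subgroup *)

(** Preserving products is enough to preserve quotients, cancellation being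
    available in the target. *)
Lemma multiplicativeF (G H : groupType) (f : {multiplicative G -> H}) :
  {morph f : x y / (x / y)%g}.
Proof. by move=> x y; rewrite -{2}(mulgVK y x) (gmulfM _ y) mulgK. Qed.

Lemma iter_multiplicativeF (G : groupType) (f : {multiplicative G -> G}) n :
  {morph iter n f : x y / (x / y)%g}.
Proof. by move=> x y; elim: n => //= n ->; rewrite multiplicativeF. Qed.

Lemma iter_multiplicative1 (G : groupType) (f : {multiplicative G -> G}) n :
  iter n f 1%g = 1%g.
Proof. by rewrite -[X in iter n f X](divgg 1%g) iter_multiplicativeF divgg. Qed.

Theorem lemma2p2 (R : realType) (Gamma : groupType) (S : set Gamma)
    (S_fin : finite_set S) (S_gen : generates S)
    (alpha : {multiplicative Gamma -> Gamma}) (r : R) (r_gt1 : 1 < r) :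
  is_subgroup (growth_le S alpha r).
Proof.
have r0 : 0 <= r by exact: le_trans ler01 (ltW r_gt1).
split.
  rewrite inE/=; apply/limn_esup_root_leP => // s rs; near=> n.
  rewrite iter_multiplicative1 word_length1//.
  by rewrite exprn_ge0// (le_trans r0 (ltW rs)).
move=> x y /set_mem xr /set_mem yr; apply/mem_set.
pose len z n : R := (word_length S (iter n alpha z))%:R.
have len0 z n : 0 <= len z n by exact: ler0n.
apply: (le_limn_esup_root (b := fun n => len x n + len y n) r0) => [n|].
  by rewrite len0/= iter_multiplicativeF -natrD ler_nat word_lengthF.
exact: (limn_esup_rootD r0 (len0 x) (len0 y) xr yr).
Unshelve. all: by end_near. Qed.
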